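(* For nonnegative integers $a,b,k$ such that $a+b\leq k-1$, $$\mathcal{D}^{(2)}_{a\bar\Lambda_0+(k-a-b)\bar\Lambda_1+b\bar\Lambda_2}(z)-\mathcal{D}^{(2)}_{(a+1)\bar\Lambda_0+(k-a-b-1)\bar\Lambda_1+b\bar\Lambda_2}(z)=\sum_{i=0}^a\sum_{j=0}^{k-a}(zq)^{k+i-a+\min\{0,j-b\}}\,q^{i+j}\,\mathcal{D}^{(2)}_{i\bar\Lambda_0+(k-i-j)\bar\Lambda_1+j\bar\Lambda_2}(zq^2).$$
   Context: Consider $3$-coloured partitions $\lambda$: finite multisets of parts, each a positive integer $i$ (size) with a colour $c\in\{1,2,3\}$, such that all parts of colour $2$ are odd and all parts of colours $1$ and $3$ are even. Let $f_i^{(c)}$ be the multiplicity of parts of size $i\geq1$ and colour $c$, $|\lambda|=\sum_{i,c}if_i^{(c)}$, $l(\lambda)=\sum_{i,c}f_i^{(c)}$. Given nonnegative integers $k_0,k_1,k_2$ put $f_0^{(1)}:=k_0$, $f_{-1}^{(2)}:=k_1$, $f_0^{(3)}:=k_2$. A path is a triple $(p_1,p_2,p_3)=(f^{(1)}_{i_1},f^{(2)}_{i_2},f^{(3)}_{i_3})$ with $i_1,i_3\in\{0,2,4,\dots\}$, $i_2\in\{-1,1,3,\dots\}$ and $|i_1-i_2|=|i_2-i_3|=1$. Let $\mathscr{D}_{k_0,k_1,k_2}$ be the set of such coloured partitions with $p_1+p_2+p_3\leq k_0+k_1+k_2$ for all paths, and define the formal power series $$\mathcal{D}^{(2)}_{k_0\bar\Lambda_0+k_1\bar\Lambda_1+k_2\bar\Lambda_2}(z)=\mathcal{D}^{(2)}_{k_0\bar\Lambda_0+k_1\bar\Lambda_1+k_2\bar\Lambda_2}(z,q):=\sum_{\lambda\in\mathscr{D}_{k_0,k_1,k_2}}z^{l(\lambda)}q^{|\lambda|}.$$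 The symbols $\bar\Lambda_0,\bar\Lambda_1,\bar\Lambda_2$ (scaled fundamental weights of $\mathrm{D}^{(2)}_3$) only serve to index the triple $(k_0,k_1,k_2)$. *)

(* Defs.v *)
From HB Require Import structures.
From mathcomp Require Import all_boot all_order all_algebra.
From mathcomp Require Import finmap multiset.
From mathcomp Require Import mathcomp_extra boolp classical_sets functions cardinality.

Set Implicit Arguments.
Unset Strict Implicit.
Unset Printing Implicit Defensive.

Import Order.TTheory GRing.Theory Num.Theory.

Local Open Scope ring_scope.

Record fps (R : Type) := Fps { fps_coef : nat -> R }.

HB.instance Definition _ (R : choiceType) := gen_eqMixin (fps R).
HB.instance Definition _ (R : choiceType) := gen_choiceMixin (fps R).

Lemma fpsP (R : Type) (F G : fps R) :
  (forall n, fps_coef F n = fps_coef G n) <-> F = G.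
Proof. by split=> [|->//]; case: F G => f [g] /= /funext ->. Qed.

Section FpsZmodule.
Variable R : zmodType.
Implicit Types F G H : fps R.

Definition fps_zero : fps R := Fps (fun=> 0).
Definition fps_opp F : fps R := Fps (fun n => - fps_coef F n).
Definition fps_add F G : fps R := Fps (fun n => fps_coef F n + fps_coef G n).

Fact fps_addA : associative fps_add.
Proof. by move=> F G H; apply/fpsP=> n /=; rewrite addrA. Qed.
Fact fps_addC : commutative fps_add.
Proof. by move=> F G; apply/fpsP=> n /=; rewrite addrC. Qed.
Fact fps_add0 : left_id fps_zero fps_add.
Proof. by move=> F; apply/fpsP=> n /=; rewrite add0r. Qed.
Fact fps_addN : left_inverse fps_zero fps_opp fps_add.
Proof. by move=> F; apply/fpsP=> n /=; rewrite addNr. Qed.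

HB.instance Definition _ :=
  GRing.isZmodule.Build (fps R) fps_addA fps_addC fps_add0 fps_addN.

Lemma fps_coef0 n : fps_coef (0 : fps R) n = 0. Proof. by []. Qed.
Lemma fps_coefD F G n : fps_coef (F + G) n = fps_coef F n + fps_coef G n.
Proof. by []. Qed.
Lemma fps_coefN F n : fps_coef (- F) n = - fps_coef F n. Proof. by []. Qed.
Lemma fps_coefB F G n : fps_coef (F - G) n = fps_coef F n - fps_coef G n.
Proof. by []. Qed.
Lemma fps_coef_sum (I : Type) (r : seq I) (P : pred I) (F : I -> fps R) n :
  fps_coef (\sum_(i <- r | P i) F i) n = \sum_(i <- r | P i) fps_coef (F i) n.
Proof. exact: (big_morph (fun G => fps_coef G n)). Qed.

End FpsZmodule.

Section FpsRing.
Variable R : comNzRingType.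
Implicit Types F G H : fps R.

Definition fpsC (c : R) : fps R := Fps (fun n => if n == 0%N then c else 0).
Definition fpsX : fps R := Fps (fun n => (n == 1%N)%:R).
Definition fps_mul F G : fps R :=
  Fps (fun n => \sum_(i < n.+1) fps_coef F i * fps_coef G (n - i)).

Fact fps_mulC : commutative fps_mul.
Proof.
move=> F G; apply/fpsP=> n /=; rewrite (reindex_inj rev_ord_inj) /=.
by apply: eq_bigr => i _; rewrite subSS subKn ?leq_ord // mulrC.
Qed.

Fact fps_mulA : associative fps_mul.
Proof.
move=> p q r; apply/fpsP=> i; rewrite [in RHS]fps_mulC /=.
transitivity (\sum_(j < i.+1) \sum_(k < i.+1 | (k <= i - j)%N)
    fps_coef p j * (fps_coef q (i - j - k) * fps_coef r k)).
  apply: eq_bigr => /= j _.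
  have -> : \sum_(l < (i - j).+1) fps_coef q l * fps_coef r (i - j - l)
          = fps_coef (fps_mul q r) (i - j) by [].
  rewrite fps_mulC /= big_distrr /= (big_ord_narrow_leq (leq_subr _ _)) /=.
  by apply: eq_bigr => l _; congr (_ * _); rewrite mulrC.
rewrite (exchange_big_dep predT) //=; apply: eq_bigr => k _.
transitivity (\sum_(j < i.+1 | (j <= i - k)%N)
    fps_coef p j * (fps_coef q (i - j - k) * fps_coef r k)).
  apply: eq_bigl => j; rewrite -ltnS -(ltnS j) -!subSn ?leq_ord //.
  by rewrite -subn_gt0 -(subn_gt0 j) -!subnDA addnC.
rewrite (big_ord_narrow_leq (leq_subr _ _)) mulrC big_distrl /=.
by apply: eq_bigr => j _; rewrite mulrA -!subnDA addnC.
Qed.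

Fact fps_mul1 : left_id (fpsC 1) fps_mul.
Proof.
move=> F; apply/fpsP=> n /=; rewrite big_ord_recl /= mul1r subn0.
by rewrite big1 ?addr0 // => i _; rewrite mul0r.
Qed.

Fact fps_mulDl : left_distributive fps_mul (@fps_add R).
Proof.
move=> F G H; apply/fpsP=> n /=; rewrite -big_split /=.
by apply: eq_bigr => i _; rewrite mulrDl.
Qed.

Fact fps_1_neq0 : fpsC 1 != 0.
Proof.
by apply/eqP => /fpsP /(_ 0%N) /= /eqP; rewrite oner_eq0.
Qed.

HB.instance Definition _ := GRing.Zmodule_isComNzRing.Build (fps R)
  fps_mulA fps_mulC fps_mul1 fps_mulDl fps_1_neq0.

Lemma fps_coefM F G n :
  fps_coef (F * G) n = \sum_(i < n.+1) fps_coef F i * fps_coef G (n - i).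
Proof. by []. Qed.

Lemma fps_coefCM c F n : fps_coef (fpsC c * F) n = c * fps_coef F n.
Proof.
rewrite fps_coefM big_ord_recl /= subn0 big1 ?addr0 // => i _.
by rewrite mul0r.
Qed.

Lemma fps_coefXM F n :
  fps_coef (fpsX * F) n = if n is m.+1 then fps_coef F m else 0.
Proof.
rewrite fps_coefM big_ord_recl /= mul0r add0r.
case: n => [|n]; first by rewrite big_ord0.
rewrite big_ord_recl /= mul1r subSS subn0 big1 ?addr0 // => i _.
by rewrite mul0r.
Qed.

(* The substitution F(X) |-> F(c X). *)
Definition fps_scale (c : R) F : fps R := Fps (fun n => c ^+ n * fps_coef F n).

Lemma fps_scaleX c : fps_scale c fpsX = fpsC c * fpsX.
Proof.
apply/fpsP=> n; rewrite fps_coefCM /=; case: eqP => [->|_]; first by rewrite expr1.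
by rewrite !mulr0.
Qed.

Lemma fps_scaleM c F G : fps_scale c (F * G) = fps_scale c F * fps_scale c G.
Proof.
apply/fpsP=> n; rewrite fps_coefM /= big_distrr /=; apply: eq_bigr => i _.
by rewrite mulrACA -exprD subnKC ?leq_ord.
Qed.

End FpsRing.

(* Z[[z, q]] is encoded as Z[[q]][[z]]. *)
Definition z : fps (fps int) := fpsX (fps int).
Definition q : fps (fps int) := fpsC (fpsX int).

(* F(z, q) |-> F(z q^d, q) *)
Definition subst_zq (d : nat) (F : fps (fps int)) : fps (fps int) :=
  fps_scale (fpsX int ^+ d) F.

Lemma subst_zq_z d : subst_zq d z = z * q ^+ d.
Proof.
rewrite /subst_zq /z fps_scaleX mulrC /q; congr (_ * _).
elim: d => [//|d IHd]; rewrite !exprS -IHd; apply/fpsP => n.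
by rewrite fps_coefCM /=; case: ifP; rewrite ?mulr0.
Qed.

(* A part is a pair (size, colour). *)
Definition part : Type := (nat * nat)%type.

Definition part_ok (p : part) : bool :=
  (0 < p.1)%N && (if p.2 == 2%N then odd p.1
                  else (p.2 \in [:: 1; 3]%N) && ~~ odd p.1).

Definition coloured_partition (lam : {mset part}%mset) : Prop :=
  forall p, p \in lam -> part_ok p.

(* The sum ranges over the parts with multiplicity. *)
Definition weight (lam : {mset part}%mset) : nat := (\sum_(p <- lam) p.1)%N.
Definition len (lam : {mset part}%mset) : nat := size lam.

(* The extended multiplicities f_i^(c): those with i <= 0 that occur in a path
   are not read off lam but are the labels k0, k1, k2. *)
Definition freq (k0 k1 k2 : nat) (lam : {mset part}%mset)
    (i : int) (c : nat) : nat :=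
  if (i, c) == (0, 1%N) then k0
  else if (i, c) == (- 1, 2%N) then k1
  else if (i, c) == (0, 3%N) then k2
  else if i is Posz n then lam (n, c) else 0%N.

Definition is_path (i1 i2 i3 : int) : bool :=
  [&& 0 <= i1, (2 %| i1)%Z, - 1 <= i2, ~~ (2 %| i2)%Z, 0 <= i3, (2 %| i3)%Z,
      `|i1 - i2| == 1 & `|i2 - i3| == 1].

Definition Dset (k0 k1 k2 : nat) : set {mset part}%mset :=
  fun lam => coloured_partition lam /\
    forall i1 i2 i3 : int, is_path i1 i2 i3 ->
      (freq k0 k1 k2 lam i1 1 + freq k0 k1 k2 lam i2 2 + freq k0 k1 k2 lam i3 3
        <= k0 + k1 + k2)%N.

Definition Dset_lw (k0 k1 k2 n m : nat) : set {mset part}%mset :=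
  fun lam => [/\ Dset k0 k1 k2 lam, len lam = n & weight lam = m].

(* fset_set is junk (empty) on infinite sets, so D2 below depends on this. *)
Lemma finite_Dset_lw k0 k1 k2 n m : finite_set (Dset_lw k0 k1 k2 n m).
Proof.
pose f (t : n.-tuple ('I_m.+1 * 'I_4)) : {mset part}%mset :=
  seq_mset [seq (nat_of_ord p.1, nat_of_ord p.2) | p <- t].
apply: (@sub_finite_set _ _ (f @` setT)%classic); last first.
  by apply: finite_image; exact: finite_finset.
move=> lam [[lamP _] ln lw] /=.
have sz : size [seq (inord p.1 : 'I_m.+1, inord p.2 : 'I_4) | p <- lam] == n.
  by rewrite size_map -ln.
exists (Tuple sz) => //; rewrite /f /= -map_comp map_id_in ?seq_mset_id //.
move=> p plam /=; have pok := lamP p plam.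
rewrite !inordK; first by case: (p).
- case/andP: pok => _; case: eqP => [->//|_ /andP[]].
  by rewrite !inE => /orP[] /eqP ->.
- by rewrite ltnS -lw /weight (big_rem p) //= leq_addr.
Qed.

Definition D2 (k0 k1 k2 : nat) : fps (fps int) :=
  Fps (fun n => Fps (fun m => #|` fset_set (Dset_lw k0 k1 k2 n m)|%fset%:Z)).

(* Main.v *)
(* With f_0^(1), f_{-1}^(2), f_0^(3) = a, k - a - b, b, every path through i_2 = -1
   has sum at most k automatically, so the labels constrain only the multiplicities
   x = f_1^(2), i = f_2^(1), j = f_2^(3).  Raising a by one, at the expense of the
   middle label, replaces x + max(b, j) <= k - a by the strict inequality, so the
   left-hand side counts the partitions with x = k - a - max(b, j); the other path
   conditions then just say i <= a and j <= k - a.  Removing these x + i + j parts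
   and lowering all others by 2 leaves an arbitrary element of D_{i, k-i-j, j}. *)

Require Import Defs.
From mathcomp Require Import all_boot all_order all_algebra.
From mathcomp Require Import finmap multiset zify.
From mathcomp Require Import boolp classical_sets cardinality.

Set Implicit Arguments.
Unset Strict Implicit.
Unset Printing Implicit Defensive.

Import Order.TTheory GRing.Theory Num.Theory.
Local Open Scope ring_scope.

(** * Coefficients of monomials times a substituted series *)

Lemma fps_coefXnM (R : comNzRingType) (e : nat) (F : fps R) (n : nat) :
  fps_coef (fpsX R ^+ e * F) n =
  if (e <= n)%N then fps_coef F (n - e) else 0.
Proof.
elim: e n => [|e IHe] n; first by rewrite mul1r subn0.
by rewrite exprS -mulrA fps_coefXM; case: n => [//|n]; rewrite IHe.
Qed.

Lemma fpsC_exp (R : comNzRingType) (c : R) (e : nat) :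
  fpsC c ^+ e = fpsC (c ^+ e).
Proof.
elim: e => [//|e IHe]; apply/fpsP => n.
by rewrite exprS IHe fps_coefCM /= exprS; case: ifP => _ //; rewrite mulr0.
Qed.

(** The factor (zq)^e shifts both exponents by e, and z -> z q^2 multiplies the coefficient of z^(n
    - e) by q^(2(n - e)). *)
Lemma coef_monomial_subst (F : fps (fps int)) (e s n m : nat) :
  fps_coef (fps_coef ((z * q) ^+ e * q ^+ s * subst_zq 2 F) n) m =
  if (e <= n)%N && (e + s + (n - e) * 2 <= m)%N
  then fps_coef (fps_coef F (n - e)) (m - (e + s + (n - e) * 2)) else 0.
Proof.
rewrite exprMn -!mulrA fps_coefXnM; case: leqP => // _; rewrite andTb.
rewrite /q !fpsC_exp !fps_coefCM [fps_coef (subst_zq _ _) _]/= -exprM !mulrA.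
by rewrite -!exprD fps_coefXnM [(2 * _)%N]mulnC.
Qed.

(** * Path conditions indexed by natural numbers *)

(** The extended multiplicity f_{2n}^(c) for c = 1 or 3, with the label of colour [c] as first
    argument. *)
Definition level (k0 : nat) (lam : {mset part}%mset) (c n : nat) : nat :=
  if n is 0 then k0 else lam ((n * 2)%N, c).

(** A path through i_2 = 2n + 1 chooses i_1 and i_3 independently from 2n and 2n + 2, as [e] and
    [e'] record. The only other path, through i_2 = -1, consists of the three labels, so its bound
    is an equality. *)
Lemma DsetP (k0 k1 k2 : nat) (lam : {mset part}%mset) :
  Dset k0 k1 k2 lam <->
  coloured_partition lam /\ forall (n : nat) (e e' : bool),
    (level k0 lam 1 (n + e) + lam ((n * 2).+1, 2) + level k2 lam 3 (n + e')
      <= k0 + k1 + k2)%N.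
Proof.
have f1 n : freq k0 k1 k2 lam (Posz (n * 2)) 1 = level k0 lam 1 n by case: n.
have f3 n : freq k0 k1 k2 lam (Posz (n * 2)) 3 = level k2 lam 3 n by case: n.
split=> -[lamP H]; split=> //.
  move=> n e e'.
  have := H (Posz ((n + e) * 2)) (Posz (n * 2).+1) (Posz ((n + e') * 2)).
  rewrite f1 f3; apply; rewrite /is_path; case: e e' => -[]; lia.
move=> i1 i2 i3; have [->|i2N] := eqVneq i2 (- 1) => pth.
  have -> : i1 = 0 by move: pth; rewrite /is_path; lia.
  have -> : i3 = 0 by move: pth; rewrite /is_path; lia.
  by [].
have [n [e [e' [-> -> ->]]]] : exists n (e e' : bool),
    [/\ i1 = Posz ((n + e) * 2), i2 = Posz (n * 2).+1 & i3 = Posz ((n + e') * 2)].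
  exists (absz i2)./2, (i2 < i1), (i2 < i3).
  by move: pth i2N; rewrite /is_path => pth i2N; split; lia.
by rewrite f1 f3; exact: H.
Qed.

(** * Attaching and detaching the parts of size at most 2 *)

(* For a coloured partition mu, [attach x i j mu] has f_1^(2) = x, f_2^(1) = i and
   f_2^(3) = j; parts of mu of size 0 would spoil the last two. *)
Definition attach (x i j : nat) (mu : {mset part}%mset) : {mset part}%mset :=
  seq_mset (nseq x (1, 2) ++ nseq i (2, 1) ++ nseq j (2, 3) ++
            [seq (p.1.+2, p.2) | p <- mu])%N.

Definition detach (lam : {mset part}%mset) : {mset part}%mset :=
  seq_mset [seq (p.1 - 2, p.2)%N | p <- lam & (2 < p.1)%N].

Lemma attach_unshift (x i j : nat) (mu : {mset part}%mset) (n c : nat) :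
  attach x i j mu (n.+2, c) =
  (((n, c) == (0, 1)) * i + ((n, c) == (0, 3)) * j + mu (n, c))%N.
Proof.
rewrite mset_seqE !count_cat !count_nseq count_map /= -(count_mem_mset (n, c) mu).
rewrite !xpair_eqE !eqSS !addnA ![(0 == n)%N]eq_sym ![(_ == c)%N]eq_sym.
by congr (_ + _ + _)%N; apply: eq_count => -[s d].
Qed.

Lemma attach1 (x i j : nat) (mu : {mset part}%mset) (c : nat) :
  attach x i j mu (1, c)%N = ((c == 2) * x)%N.
Proof.
rewrite mset_seqE !count_cat !count_nseq count_map /= !xpair_eqE /= eq_sym.
by rewrite (eq_count (a2 := pred0)) ?count_pred0 ?addn0.
Qed.

Lemma attach0 (x i j : nat) (mu : {mset part}%mset) (c : nat) :
  attach x i j mu (0, c)%N = 0%N.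
Proof.
rewrite mset_seqE !count_cat !count_nseq count_map /=.
by rewrite (eq_count (a2 := pred0)) ?count_pred0.
Qed.

Lemma attach_inj (x i j : nat) : injective (attach x i j).
Proof.
move=> mu nu /msetP eq_mn; apply/msetP => -[n c].
by have := eq_mn (n.+2, c); rewrite !attach_unshift => /addnI.
Qed.

Lemma len_attach (x i j : nat) (mu : {mset part}%mset) :
  len (attach x i j mu) = (x + i + j + len mu)%N.
Proof.
rewrite /len (perm_size (perm_eq_seq_mset _)) !size_cat !size_nseq size_map.
by rewrite !addnA.
Qed.

Lemma weight_attach (x i j : nat) (mu : {mset part}%mset) :
  weight (attach x i j mu) = (x + (i + j) * 2 + len mu * 2 + weight mu)%N.
Proof.
rewrite /weight (perm_big _ (perm_eq_seq_mset _)) /= !big_cat big_map /=.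
rewrite !big_nseq /= !iter_addn_0.
under [X in (_ + (_ + (_ + X)))%N]eq_bigr => p _ do rewrite -addn2.
rewrite big_split /= big_const_seq count_predT iter_addn_0 /len.
by set S := (\sum_(p <- mu) p.1)%N; set l := size mu; lia.
Qed.

Lemma detachE (lam : {mset part}%mset) (n c : nat) :
  detach lam (n, c) = if n is 0 then 0%N else lam (n.+2, c).
Proof.
rewrite mset_seqE count_map count_filter; case: n => [|n].
  rewrite (eq_count (a2 := pred0)) ?count_pred0 // => -[s d] /=.
  by rewrite xpair_eqE; lia.
rewrite -count_mem_mset; apply: eq_count => -[s d] /=.
by rewrite !xpair_eqE; lia.
Qed.

Lemma coloured_attach (x i j : nat) (mu : {mset part}%mset) :
  coloured_partition mu -> coloured_partition (attach x i j mu).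
Proof.
move=> muP [[|[|n]] c]; rewrite in_mset ?attach0 ?attach1 ?attach_unshift //.
  by case: (eqVneq c 2%N) => [->|].
rewrite !addn_gt0 => /orP[/orP[]|].
- by case: eqP => // -[-> ->].
- by case: eqP => // -[-> ->].
by rewrite -in_mset => /muP /andP[_]; rewrite /part_ok /= negbK.
Qed.

Lemma coloured_detach (lam : {mset part}%mset) :
  coloured_partition lam -> coloured_partition (detach lam).
Proof.
move=> lamP [n c]; rewrite in_mset detachE; case: n => // n.
by rewrite -in_mset => /lamP; rewrite /part_ok /= negbK.
Qed.

Lemma coloured_eq0 (lam : {mset part}%mset) (n c : nat) :
  coloured_partition lam -> ~~ part_ok (n, c) -> lam (n, c) = 0%N.
Proof.
by move=> lamP /negP npok; apply/eqP; rewrite mset_eq0; apply/negP => /lamP.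
Qed.

(** In a coloured partition, size 1 occurs only in colour 2 and size 2 only in colours 1 and 3, so
    three multiplicities recover all that [detach] discards. *)
Lemma attach_detach (lam : {mset part}%mset) :
  coloured_partition lam ->
  attach (lam (1, 2)%N) (lam (2, 1)%N) (lam (2, 3)%N) (detach lam) = lam.
Proof.
move=> lamP; apply/msetP => -[[|[|n]] c].
- by rewrite attach0 coloured_eq0.
- rewrite attach1; case: (eqVneq c 2%N) => [->|c2]; first by rewrite mul1n.
  by rewrite mul0n (coloured_eq0 lamP) // /part_ok /= (negPf c2) andbF.
rewrite attach_unshift detachE; case: n => [|n]; last by rewrite !xpair_eqE.
rewrite addn0 !xpair_eqE !eqxx /=.
case: (eqVneq c 1%N) => [->|c1]; first by rewrite mul1n addn0.
case: (eqVneq c 3%N) => [->|c3]; first by rewrite mul1n.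
rewrite (coloured_eq0 (n := 2) (c := c) lamP) //.
by rewrite /part_ok /= !inE (negPf c1) (negPf c3); case: ifP.
Qed.

(** The paths of [attach x i j mu] through i_2 = 2n + 3 are those of [mu] through 2n + 1, the
    attached parts of size 2 acting as the labels i and j; the middle label k - i - j keeps the
    total at k. The four paths through i_2 = 1 give the four inequalities. *)
Lemma Dset_attach (k k0 k1 k2 x i j : nat) (mu : {mset part}%mset) :
  (k0 + k1 + k2 = k)%N -> (i + j <= k)%N -> coloured_partition mu ->
  Dset k0 k1 k2 (attach x i j mu) <->
  [/\ (x <= k1)%N, (i + x <= k0 + k1)%N, (x + j <= k1 + k2)%N,
      (i + x + j <= k)%N & Dset i (k - i - j) j mu].
Proof.
move=> defk le_ij muP.
have lamP : coloured_partition (attach x i j mu) by exact: coloured_attach.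
have sumk : (i + (k - i - j) + j = k)%N by lia.
have mu0 c : mu (0, c)%N = 0%N by apply: coloured_eq0.
have lvl1 n h : level h (attach x i j mu) 1 n.+1 = level i mu 1 n.
  by rewrite /level attach_unshift; case: n => [|n]; rewrite ?mu0 !xpair_eqE //=; lia.
have lvl3 n h : level h (attach x i j mu) 3 n.+1 = level j mu 3 n.
  by rewrite /level attach_unshift; case: n => [|n]; rewrite ?mu0 !xpair_eqE //=; lia.
have mid n : attach x i j mu ((n.+1 * 2).+1, 2)%N = mu ((n * 2).+1, 2)%N.
  by rewrite mulSn attach_unshift !xpair_eqE.
rewrite DsetP defk; split=> [[_ H]|[H1 H2 H3 H4 /DsetP[_]]]; last rewrite sumk => H.
  have H0 e e' := H 0%N e e'; rewrite attach1 in H0.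
  split; first by have := H0 false false; rewrite /=; lia.
  - by have := H0 true false; rewrite lvl1 /=; lia.
  - by have := H0 false true; rewrite lvl3 /=; lia.
  - by have := H0 true true; rewrite lvl1 lvl3 /=; lia.
  apply/DsetP; rewrite sumk; split=> // n e e'; have := H n.+1 e e'.
  by rewrite !addSn lvl1 lvl3 mid.
split=> // -[|n] e e'; last by rewrite !addSn lvl1 lvl3 mid.
by rewrite attach1; case: e e' => -[]; rewrite ?lvl1 ?lvl3 /=; lia.
Qed.

Lemma Dset_le (k0 k1 k2 : nat) (lam : {mset part}%mset) :
  Dset k0 k1 k2 lam -> (lam (2, 1) + lam (1, 2) + lam (2, 3) <= k0 + k1 + k2)%N.
Proof. by case/DsetP => _ /(_ 0%N true true). Qed.

(** * The difference of the two sets of partitions *)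

Section Difference.
Variables (a b k : nat).
Hypothesis abk : (a + b < k)%N.

Let sumk : (a + (k - a - b) + b = k)%N. Proof. by lia. Qed.
Let sumk' : (a.+1 + (k - a - b - 1) + b = k)%N. Proof. by lia. Qed.

(** Of the four inequalities of [Dset_attach], raising the first label changes only the bounds k1
    and k1 + k2, lowering each by one. *)
Lemma Dset_subset (lam : {mset part}%mset) :
  Dset a.+1 (k - a - b - 1) b lam -> Dset a (k - a - b) b lam.
Proof.
move=> Dlam; have [lamP _] := Dlam; have := Dset_le Dlam; rewrite sumk' => le_k.
have le_ij : (lam (2, 1) + lam (2, 3) <= k)%N by lia.
have muP := coloured_detach lamP.
move: Dlam; rewrite -(attach_detach lamP) => /(Dset_attach _ sumk' le_ij muP).
case=> le1 le2 le3 le4 Dmu; apply/(Dset_attach _ sumk le_ij muP).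
by split=> //; lia.
Qed.

(** The bounds i + x <= k - b and i + x + j <= k together say i + x + max(b, j) <= k, which is i <=
    a once x + max(b, j) = k - a. Since b and j are at most k - a, the truncated subtraction is
    exact. *)
Lemma Dset_difference (x i j : nat) (mu : {mset part}%mset) :
  coloured_partition mu -> (i + j <= k)%N ->
  (Dset a (k - a - b) b (attach x i j mu) /\
    ~ Dset a.+1 (k - a - b - 1) b (attach x i j mu)) <->
  [/\ (i <= a)%N, (j <= k - a)%N, x = (k - a - maxn b j)%N
    & Dset i (k - i - j) j mu].
Proof.
move=> muP le_ij; rewrite !(Dset_attach _ _ le_ij muP) //.
split=> [[[le1 le2 le3 le4 Dmu] nD]|[le1 le2 -> Dmu]]; last first.
  by split=> [|[]]; first (split=> //); lia.
have ge_x : (k - a <= x + maxn b j)%N.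
  by rewrite leqNgt; apply/negP => lt_x; apply: nD; split=> //; lia.
by split=> //; lia.
Qed.

Lemma Dset_difference_bounds (lam : {mset part}%mset) :
  Dset a (k - a - b) b lam -> ~ Dset a.+1 (k - a - b - 1) b lam ->
  (lam (2, 1) <= a)%N /\ (lam (2, 3) <= k - a)%N.
Proof.
move=> Dlam nD; have [lamP _] := Dlam; have := Dset_le Dlam; rewrite sumk => le_k.
have le_ij : (lam (2, 1) + lam (2, 3) <= k)%N by lia.
have [] // := (Dset_difference (lam (1, 2)%N) (coloured_detach lamP) le_ij).1.
by rewrite attach_detach.
Qed.

End Difference.

(** * Counting the difference by fibres *)

Lemma sum_nat_eq1 (y N : nat) : (y < N)%N -> (\sum_(0 <= i < N) (y == i) = 1)%N.
Proof.
move=> ltyN; rewrite (bigD1_seq y) ?mem_index_iota ?iota_uniq //= eqxx.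
by rewrite big1 // => i /negPf iy; rewrite eq_sym iy.
Qed.

Lemma card_fset_fibers (T : choiceType) (G : {fset T}) (f g : T -> nat) (M N : nat) :
  (forall x, x \in G -> (f x < M)%N && (g x < N)%N) ->
  #|` G|%fset = (\sum_(0 <= i < M) \sum_(0 <= j < N)
    #|` [fset x in G | (f x == i) && (g x == j)]|%fset)%N.
Proof.
move=> ltG; rewrite card_fset_sum1.
under [RHS]eq_bigr => i _.
  under eq_bigr => j _ do rewrite card_fset_sum1 -big_fset_condE big_mkcond.
  rewrite exchange_big; over.
rewrite exchange_big; apply: eq_big_seq => x /ltG /andP[ltM ltN].
rewrite -[LHS](sum_nat_eq1 ltM); apply: eq_bigr => i _.
case: eqP => /= _; last by rewrite big1.
by rewrite -[LHS](sum_nat_eq1 ltN); apply: eq_bigr => j _; case: eqP.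
Qed.

(** Here [e] is the number of attached parts and e + (i + j) their weight; each of the other n - e
    parts was raised by 2, which gives [w]. *)
Lemma card_difference_fiber (a b k i j n m : nat) :
  (a + b < k)%N -> (i <= a)%N -> (j <= k - a)%N ->
  let e := (k - a - maxn b j + i + j)%N in
  let w := (e + (i + j) + (n - e) * 2)%N in
  #|` [fset lam in fset_set (Dset_lw a (k - a - b) b n m) `\`
                   fset_set (Dset_lw a.+1 (k - a - b - 1) b n m)
         | (lam (2, 1)%N == i) && (lam (2, 3)%N == j)]|%fset =
  (if (e <= n)%N && (w <= m)%N
   then #|` fset_set (Dset_lw i (k - i - j) j (n - e) (m - w))|%fset else 0%N).
Proof.
move=> abk le_i le_j e w; set G := (X in #|` X|%fset); set x := (k - a - maxn b j)%N.
have le_ij : (i + j <= k)%N by lia.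
(* Length and weight are stated as sums, without truncated subtraction, so that this description
   also serves when the fibre is empty. *)
have GP lam : lam \in G <-> exists mu,
    [/\ lam = attach x i j mu, Dset i (k - i - j) j mu,
        (x + i + j + len mu = n)%N & (x + (i + j) * 2 + len mu * 2 + weight mu = m)%N].
  rewrite /G !inE /= !in_fset_set; try exact: finite_Dset_lw.
  split.
    case/andP => /andP[/negP nD /set_mem[Dlam ln wt]] /andP[/eqP li /eqP lj].
    have [lamP _] := Dlam; have muP := coloured_detach lamP.
    have lamE := attach_detach lamP; rewrite li lj in lamE.
    have [] := (Dset_difference abk (lam (1, 2)%N) muP le_ij).1.
      by rewrite lamE; split=> // Dlam'; apply: nD; apply/mem_set.
    move=> _ _ xE Dmu; rewrite xE in lamE.
    exists (detach lam); split=> //; first by rewrite -ln -{2}lamE len_attach.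
    by rewrite -wt -{3}lamE weight_attach.
  case=> mu [-> Dmu <- <-]; have [muP _] := Dmu.
  have [D nD] := (Dset_difference abk x muP le_ij).2 (And4 le_i le_j erefl Dmu).
  have mu0 c : mu (0, c)%N = 0%N by apply: coloured_eq0.
  rewrite !attach_unshift !mu0 !xpair_eqE /= !mul1n !mul0n !addn0 !eqxx !andbT.
  apply/andP; split; first by apply/negP => /set_mem [/nD].
  by apply/mem_set; split; rewrite ?len_attach ?weight_attach.
case: ifP => [/andP[le_e le_w]|/negP nle].
  have -> : G = (attach x i j @` fset_set (Dset_lw i (k - i - j) j (n - e) (m - w)))%fset.
    apply/fsetP => lam; apply/idP/imfsetP => /= [/GP[mu [-> Dmu ln wt]]|[mu]].
      exists mu => //; rewrite in_fset_set; last exact: finite_Dset_lw.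
      by apply/mem_set; split=> //; rewrite /w /e -/x; lia.
    rewrite in_fset_set; last exact: finite_Dset_lw.
    move=> /set_mem[Dmu ln wt] ->; apply/GP; exists mu.
    by move: le_e le_w wt ln; rewrite /w /e -/x => *; split=> //; lia.
  by rewrite card_imfset //; exact: attach_inj.
(* Any member of the fibre would force e <= n and w <= m. *)
apply/eqP; rewrite cardfs_eq0; apply/fset0Pn => -[lam /GP[mu [_ _ ln wt]]].
by apply: nle; rewrite /w /e -/x; lia.
Qed.

Lemma card_difference (a b k n m : nat) : (a + b < k)%N ->
  #|` fset_set (Dset_lw a (k - a - b) b n m)|%fset%:Z -
  #|` fset_set (Dset_lw a.+1 (k - a - b - 1) b n m)|%fset%:Z =
  #|` fset_set (Dset_lw a (k - a - b) b n m) `\`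
      fset_set (Dset_lw a.+1 (k - a - b - 1) b n m)|%fset%:Z.
Proof.
move=> abk; set F := fset_set _; set F' := fset_set (Dset_lw a.+1 _ _ _ _).
have sub : (F' `<=` F)%fset.
  rewrite -fset_set_sub; try exact: finite_Dset_lw.
  by move=> lam [D ln wt]; split=> //; exact: Dset_subset.
by rewrite cardfsDS // subzn // fsubset_leq_card.
Qed.

(* The exponent of z * q is at least 1 for all i, j in the range of summation,
   so absz only casts it from int to nat. *)
Theorem proposition4p5 (a b k : nat) (hab : a%:Z + b%:Z <= k%:Z - 1) :
  D2 a (k - a - b)%N b - D2 a.+1 (k - a - b - 1)%N b =
  \sum_(0 <= i < a.+1) \sum_(0 <= j < (k - a).+1)
    (z * q) ^+ absz (k%:Z + i%:Z - a%:Z + Num.min 0 (j%:Z - b%:Z))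
    * q ^+ (i + j)
    * subst_zq 2 (D2 i (k - i - j)%N j).
Proof.
have abk : (a + b < k)%N by lia.
apply/fpsP => n; apply/fpsP => m.
rewrite [LHS](card_difference n m abk).
(* The summation indices are the values of f_2^(1) and f_2^(3). *)
rewrite (card_fset_fibers (f := fun lam : {mset part}%mset => lam (2, 1)%N)
  (g := fun lam : {mset part}%mset => lam (2, 3)%N)
  (M := a.+1) (N := (k - a).+1)); last first.
  move=> lam; rewrite in_fsetD !in_fset_set; try exact: finite_Dset_lw.
  case/andP => /negP nD /set_mem[Dlam ln wt].
  have [|/= le1 le2] := Dset_difference_bounds abk Dlam; last by rewrite !ltnS le1.
  by move=> Dlam'; apply: nD; apply/mem_set.
rewrite !fps_coef_sum (big_morph Posz PoszD (erefl 0)).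
apply: eq_big_nat => i /andP[_ le_i].
rewrite !fps_coef_sum (big_morph Posz PoszD (erefl 0)).
apply: eq_big_nat => j /andP[_ le_j].
rewrite (card_difference_fiber _ _ abk) // coef_monomial_subst.
(* Because j - max(b, j) = min(0, j - b), the exponent is the number of attached parts. *)
have -> : absz (k%:Z + i%:Z - a%:Z + Num.min 0 (j%:Z - b%:Z))
    = (k - a - maxn b j + i + j)%N by lia.
by case: ifP.
Qed.
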